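(* Let $f:\mathbb{R}^n\times\mathbb{R}^m\to\mathbb{R}$ be twice continuously differentiable, $\mu$-strongly convex in $x$ and $\mu$-strongly concave in $y$ ($\mu>0$), with the largest singular value of $\nabla F(z)$ at most $L$ for all $z$ and $\|\nabla F(z)-\nabla F(z')\|\le L_2\|z-z'\|$, where $z=(x;y)$ and $F(z)=(\nabla_x f(x,y);-\nabla_y f(x,y))$. Let $m(z)=\frac12\|F(z)\|^2$, for a starting point $z^0$ let $D=\max\{\|z-z^0\|: m(z)\le m(z^0)\}$ and $L_m=L^2+LL_2D$. Let $\{z^k\}$ be generated by the CRN-SPP method (described in the context) with $\alpha=\frac{\mu^2}{2L_m}$. Then $\{m(z^k)\}$ converges linearly to $0$: $$m(z^{k+1})\le\Big(1-\frac{\mu^2}{6L_m}\Big)^2m(z^k).$$ As a result, it takes at most $\mathcal{O}\big((\kappa^2+\kappa\cdot\frac{L_2}{\mu})\ln(\frac1\epsilon)\big)$ iterations to find a point $\bar z$ with $m(\bar z)\le\epsilon$, where $\kappa=L/\mu$.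
   Context: CRN-SPP with parameters $\bar\gamma>0$, $\rho,\alpha\in(0,1)$: at iterate $z^k=(x^k;y^k)$ let $g^k=\nabla f(z^k)$, $H^k=\nabla^2 f(z^k)$ and for $\gamma>0$ define $f_k(x,y;\gamma)=f(z^k)+\langle g^k,z-z^k\rangle+\frac12(z-z^k)^\top H^k(z-z^k)+\frac{\gamma}{3}\|x-x^k\|^3-\frac{\gamma}{3}\|y-y^k\|^3$. Set $\gamma^k=\bar\gamma$, compute the saddle point $(\tilde x,\tilde y)$ of $\min_x\max_y f_k(x,y;\gamma^k)$, and let $u^k=\tilde x-x^k$, $v^k=\tilde y-y^k$; while $\gamma^k(\|u^k\|+\|v^k\|)>\mu$, replace $\gamma^k$ by $\rho\gamma^k$ and recompute. Set $d^k=(u^k;v^k)$, and $z^{k+1}=z^k+\alpha d^k$ if $m(z^k+\alpha d^k)<m(z^k+d^k)$, otherwise $z^{k+1}=z^k+d^k$. Norms: Euclidean for vectors, largest singular value for matrices. *)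

(* Defs.v *)
From HB Require Import structures.
From mathcomp Require Import all_boot all_order all_algebra.
From mathcomp Require Import all_classical all_reals all_analysis.
Set Implicit Arguments. Unset Strict Implicit. Unset Printing Implicit Defensive.
Import Order.TTheory GRing.Theory Num.Theory.
Local Open Scope ring_scope.
Local Open Scope classical_set_scope.

Section CRN.
Variable R : realType.

Definition dotv (N : nat) (u v : 'cV[R]_N) : R := (u^T *m v) 0 0.
Definition enorm (N : nat) (v : 'cV[R]_N) : R := Num.sqrt (dotv v v).

(* Spectral norm (largest singular value) = operator norm induced by the
   Euclidean norm. *)
Definition spec_norm (p q : nat) (A : 'M[R]_(p, q)) : R :=
  sup [set enorm (A *m v) | v in [set v : 'cV[R]_q | enorm v <= 1]].

Variables n m : nat.
(* z = (x; y) in R^(n+m): x = usubmx z, y = dsubmx z, z = col_mx x y. *)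

Definition signJ : 'M[R]_(n + m) := block_mx 1%:M 0 0 (- 1%:M).

(* F(z) = (grad_x f(z); - grad_y f(z)), given the gradient g of f. *)
Definition Fmap (g : 'cV[R]_(n + m) -> 'cV[R]_(n + m)) (z : 'cV[R]_(n + m))
  : 'cV[R]_(n + m) := signJ *m g z.
(* Jacobian of F, given the Hessian H of f. *)
Definition JF (H : 'cV[R]_(n + m) -> 'M[R]_(n + m)) (z : 'cV[R]_(n + m))
  : 'M[R]_(n + m) := signJ *m H z.
Definition merit (g : 'cV[R]_(n + m) -> 'cV[R]_(n + m)) (z : 'cV[R]_(n + m)) : R :=
  2^-1 * enorm (Fmap g z) ^+ 2.

Definition strongly_convex_in_x (f : 'cV[R]_(n + m) -> R) (mu : R) :=
  forall (x1 x2 : 'cV[R]_n) (y : 'cV[R]_m) (t : R), 0 <= t <= 1 ->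
    f (col_mx (t *: x1 + (1 - t) *: x2) y) <=
      t * f (col_mx x1 y) + (1 - t) * f (col_mx x2 y)
      - mu / 2 * t * (1 - t) * enorm (x1 - x2) ^+ 2.

Definition strongly_concave_in_y (f : 'cV[R]_(n + m) -> R) (mu : R) :=
  forall (x : 'cV[R]_n) (y1 y2 : 'cV[R]_m) (t : R), 0 <= t <= 1 ->
    t * f (col_mx x y1) + (1 - t) * f (col_mx x y2)
      + mu / 2 * t * (1 - t) * enorm (y1 - y2) ^+ 2
    <= f (col_mx x (t *: y1 + (1 - t) *: y2)).

Definition crn_model (f : 'cV[R]_(n + m) -> R) (g : 'cV[R]_(n + m) -> 'cV[R]_(n + m))
  (H : 'cV[R]_(n + m) -> 'M[R]_(n + m)) (zk : 'cV[R]_(n + m)) (gam : R)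
  (x : 'cV[R]_n) (y : 'cV[R]_m) : R :=
  let w := col_mx x y - zk in
  f zk + dotv (g zk) w + 2^-1 * dotv w (H zk *m w)
  + gam / 3 * enorm (x - usubmx zk) ^+ 3 - gam / 3 * enorm (y - dsubmx zk) ^+ 3.

Definition is_saddle (phi : 'cV[R]_n -> 'cV[R]_m -> R) (xt : 'cV[R]_n) (yt : 'cV[R]_m) :=
  forall x y, phi xt y <= phi xt yt /\ phi xt yt <= phi x yt.

(* One iteration of CRN-SPP from zk to zk1: gamma^k = gbar * rho^j where j
   is the number of backtracking reductions performed by the while loop. *)
Definition crn_step (f : 'cV[R]_(n + m) -> R) (g : 'cV[R]_(n + m) -> 'cV[R]_(n + m))
  (H : 'cV[R]_(n + m) -> 'M[R]_(n + m)) (mu gbar rho alpha : R)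
  (zk zk1 : 'cV[R]_(n + m)) : Prop :=
  exists (j : nat) (xt : 'cV[R]_n) (yt : 'cV[R]_m),
    let gam := gbar * rho ^+ j in
    let u := xt - usubmx zk in
    let v := yt - dsubmx zk in
    let d := col_mx u v in
    [/\ is_saddle (crn_model f g H zk gam) xt yt,
        gam * (enorm u + enorm v) <= mu,
        (forall i : nat, (i < j)%N -> forall (xt' : 'cV[R]_n) (yt' : 'cV[R]_m),
            is_saddle (crn_model f g H zk (gbar * rho ^+ i)) xt' yt' ->
            mu < gbar * rho ^+ i * (enorm (xt' - usubmx zk) + enorm (yt' - dsubmx zk)))
      & zk1 = (if merit g (zk + alpha *: d) < merit g (zk + d)
               then zk + alpha *: d else zk + d)].

End CRN.

(* Main.v *)
(* A saddle point of the cubic model satisfies F(z) + JF(z) d + Q = 0 with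
   Q = gamma (|u| u; |v| v). Since gamma (|u| + |v|) <= mu while JF(z) is
   mu-strongly monotone, Q cannot cancel JF(z) d, and d is a descent direction:
   <F, JF d> + mu^2 |d|^2 / 4 <= - |F|^2 / 3. On the initial level set
   |F| <= L D, so m(z + h) <= m(z) + <F, JF h> + Lm |h|^2 / 2; with h = alpha d
   this gives m(z + alpha d) <= (1 - 2 alpha / 3) m(z) <= (1 - alpha / 3)^2 m(z).
   The bound |F| <= L D does not use the existence of a zero of F: gradient-like
   iterates w - (mu / L^2) F(w) stay in the level set and drive |F| to 0. *)

Require Import Defs.
From HB Require Import structures.
From mathcomp Require Import all_boot all_order all_algebra.
From mathcomp Require Import all_classical all_reals all_analysis.
From mathcomp Require Import ring lra.
Import Order.TTheory GRing.Theory Num.Theory.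
Import numFieldNormedType.Exports.
Local Open Scope ring_scope.
Local Open Scope classical_set_scope.

(** * Euclidean inner product, operator norm and the sign matrix *)

Section Euclidean.
Set Implicit Arguments.
Unset Strict Implicit.
Variable R : realType.
Implicit Types N p q : nat.

Lemma dotvE N (u v : 'cV[R]_N) : dotv u v = \sum_i u i 0 * v i 0.
Proof. by rewrite /dotv mxE; apply: eq_bigr => i _; rewrite mxE. Qed.

Lemma dotvC N (u v : 'cV[R]_N) : dotv u v = dotv v u.
Proof. by rewrite !dotvE; apply: eq_bigr => i _; rewrite mulrC. Qed.

Lemma dotvDr N (u v w : 'cV[R]_N) : dotv u (v + w) = dotv u v + dotv u w.
Proof. by rewrite /dotv mulmxDr mxE. Qed.

Lemma dotvNr N (u v : 'cV[R]_N) : dotv u (- v) = - dotv u v.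
Proof. by rewrite /dotv mulmxN mxE. Qed.

Lemma dotvBr N (u v w : 'cV[R]_N) : dotv u (v - w) = dotv u v - dotv u w.
Proof. by rewrite dotvDr dotvNr. Qed.

Lemma dotvZr N a (u v : 'cV[R]_N) : dotv u (a *: v) = a * dotv u v.
Proof. by rewrite /dotv -scalemxAr mxE. Qed.

Lemma dotv0r N (u : 'cV[R]_N) : dotv u 0 = 0.
Proof. by rewrite /dotv mulmx0 mxE. Qed.

Lemma dotvDl N (u v w : 'cV[R]_N) : dotv (v + w) u = dotv v u + dotv w u.
Proof. by rewrite dotvC dotvDr !(dotvC u). Qed.

Lemma dotvNl N (u v : 'cV[R]_N) : dotv (- v) u = - dotv v u.
Proof. by rewrite dotvC dotvNr dotvC. Qed.

Lemma dotvBl N (u v w : 'cV[R]_N) : dotv (v - w) u = dotv v u - dotv w u.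
Proof. by rewrite dotvDl dotvNl. Qed.

Lemma dotvZl N a (u v : 'cV[R]_N) : dotv (a *: v) u = a * dotv v u.
Proof. by rewrite dotvC dotvZr dotvC. Qed.

Definition dotv_lin := (dotvDr, dotvDl, dotvNr, dotvNl, dotvZr, dotvZl).

Lemma dotv_dim0 N (u v : 'cV[R]_N) : N = 0%N -> dotv u v = 0.
Proof. by move=> N0; subst N; rewrite dotvE big_ord0. Qed.

Lemma dotv_ge0 N (u : 'cV[R]_N) : 0 <= dotv u u.
Proof. by rewrite dotvE; apply: sumr_ge0 => i _; rewrite -expr2 sqr_ge0. Qed.

Lemma dotv_eq0 N (u : 'cV[R]_N) : dotv u u = 0 -> u = 0.
Proof.
rewrite dotvE => /eqP; rewrite psumr_eq0; last first.
  by move=> i _; rewrite -expr2 sqr_ge0.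
move=> /allP h; apply/matrixP => i j; rewrite ord1 mxE.
have /implyP := h i (mem_index_enum i).
by rewrite -expr2 sqrf_eq0 => /(_ isT)/eqP.
Qed.

Lemma enorm_ge0 N (u : 'cV[R]_N) : 0 <= enorm u.
Proof. exact: sqrtr_ge0. Qed.

Lemma sqr_enorm N (u : 'cV[R]_N) : enorm u ^+ 2 = dotv u u.
Proof. by rewrite sqr_sqrtr // dotv_ge0. Qed.

Lemma enorm_eq0 N (u : 'cV[R]_N) : enorm u = 0 -> u = 0.
Proof. by move=> u0; apply: dotv_eq0; rewrite -sqr_enorm u0 expr0n. Qed.

Lemma enorm0 N : enorm (0 : 'cV[R]_N) = 0.
Proof. by rewrite /enorm dotv0r sqrtr0. Qed.

Lemma enormZ N a (u : 'cV[R]_N) : enorm (a *: u) = `|a| * enorm u.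
Proof.
by rewrite /enorm dotvZl dotvZr mulrA -expr2 sqrtrM ?sqr_ge0// sqrtr_sqr.
Qed.

Lemma enormN N (u : 'cV[R]_N) : enorm (- u) = enorm u.
Proof. by rewrite -scaleN1r enormZ normrN1 mul1r. Qed.

Lemma enormB N (u v : 'cV[R]_N) : enorm (u - v) = enorm (v - u).
Proof. by rewrite -enormN opprB. Qed.

(** Cauchy-Schwarz: expand the squared norm of [enorm v *: u - enorm u *: v] and cancel the factor
    [enorm u * enorm v], the zero vectors being set apart. *)
Lemma dotv_le N (u v : 'cV[R]_N) : dotv u v <= enorm u * enorm v.
Proof.
have [u0|u0] := eqVneq (enorm u) 0.
  by rewrite (enorm_eq0 u0) enorm0 dotvC dotv0r mul0r.
have [v0|v0] := eqVneq (enorm v) 0.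
  by rewrite (enorm_eq0 v0) enorm0 dotv0r mulr0.
have {u0} u0 : 0 < enorm u by rewrite lt_neqAle eq_sym u0 enorm_ge0.
have {v0} v0 : 0 < enorm v by rewrite lt_neqAle eq_sym v0 enorm_ge0.
have := dotv_ge0 (enorm v *: u - enorm u *: v).
rewrite !dotv_lin -!sqr_enorm (dotvC v u) => h.
rewrite -(ler_pM2l u0) -(ler_pM2l v0); nra.
Qed.

Lemma dotv_geN N (u v : 'cV[R]_N) : - (enorm u * enorm v) <= dotv u v.
Proof. by have := dotv_le (- u) v; rewrite enormN dotvNl; lra. Qed.

Lemma enorm_le N (u : 'cV[R]_N) c : 0 <= c -> dotv u u <= c ^+ 2 -> enorm u <= c.
Proof.
by move=> c0; rewrite -sqr_enorm ler_sqr // nnegrE enorm_ge0.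
Qed.

Lemma sqr_enormD N (u v : 'cV[R]_N) :
  enorm (u + v) ^+ 2 = enorm u ^+ 2 + 2 * dotv u v + enorm v ^+ 2.
Proof. by rewrite !sqr_enorm !dotv_lin (dotvC v u); ring. Qed.

Lemma enormD N (u v : 'cV[R]_N) : enorm (u + v) <= enorm u + enorm v.
Proof.
apply: enorm_le; first by rewrite addr_ge0 ?enorm_ge0.
by rewrite -sqr_enorm sqr_enormD; have := dotv_le u v; nra.
Qed.

Lemma dotv_col_mx n m (a c : 'cV[R]_n) (b d : 'cV[R]_m) :
  dotv (col_mx a b) (col_mx c d) = dotv a c + dotv b d.
Proof. by rewrite /dotv tr_col_mx mul_row_col mxE. Qed.

Lemma sqr_enorm_col n m (a : 'cV[R]_n) (b : 'cV[R]_m) :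
  enorm (col_mx a b) ^+ 2 = enorm a ^+ 2 + enorm b ^+ 2.
Proof. by rewrite !sqr_enorm dotv_col_mx. Qed.

(** Cauchy-Schwarz on each row gives the Frobenius norm as a constant. Any finite bound would do: it
    shows that the supremum in [spec_norm] is taken over a bounded set. *)
Lemma mulmx_enorm_bounded p q (A : 'M[R]_(p, q)) :
  exists2 C, 0 <= C & forall v, enorm (A *m v) <= C * enorm v.
Proof.
exists (Num.sqrt (\sum_i enorm ((row i A)^T) ^+ 2)) => [|v].
  exact: sqrtr_ge0.
apply: enorm_le; first by rewrite mulr_ge0 ?enorm_ge0 ?sqrtr_ge0.
rewrite exprMn sqr_sqrtr; last by apply: sumr_ge0 => i _; rewrite sqr_ge0.
rewrite mulr_suml dotvE; apply: ler_sum => i _.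
have -> : (A *m v) i 0 = dotv (row i A)^T v.
  by rewrite dotvE mxE; apply: eq_bigr => j _; rewrite !mxE.
have := dotv_le (row i A)^T v; have := dotv_geN (row i A)^T v.
by rewrite -expr2 -exprMn; set y := _ * enorm v; nra.
Qed.

Lemma spec_norm_sup p q (A : 'M[R]_(p, q)) :
  has_sup [set enorm (A *m v) | v in [set v : 'cV[R]_q | enorm v <= 1]].
Proof.
split; first by exists (enorm (A *m 0)), 0 => //=; rewrite enorm0 ler01.
have [C C0 hC] := mulmx_enorm_bounded A.
exists C => _ [v /= v1 <-]; apply: le_trans (hC v) _.
by rewrite -[leRHS]mulr1 ler_wpM2l.
Qed.

Lemma spec_norm_ge0 p q (A : 'M[R]_(p, q)) : 0 <= spec_norm A.
Proof.
apply: sup_upper_bound (spec_norm_sup A) _ _.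
by exists 0 => /=; rewrite ?mulmx0 enorm0.
Qed.

Lemma enorm_mulmx_le p q (A : 'M[R]_(p, q)) v :
  enorm (A *m v) <= spec_norm A * enorm v.
Proof.
have [v0|v0] := eqVneq (enorm v) 0.
  by rewrite (enorm_eq0 v0) mulmx0 !enorm0 mulr0.
have vp : 0 < enorm v by rewrite lt_neqAle eq_sym v0 enorm_ge0.
rewrite -ler_pdivrMr// mulrC.
have -> : (enorm v)^-1 * enorm (A *m v) = enorm (A *m ((enorm v)^-1 *: v)).
  by rewrite -scalemxAr enormZ ger0_norm // invr_ge0 enorm_ge0.
apply: sup_upper_bound (spec_norm_sup A) _ _.
exists ((enorm v)^-1 *: v) => //=.
by rewrite enormZ ger0_norm ?invr_ge0 ?enorm_ge0// mulVf.
Qed.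

Lemma enorm_mulmx_le_of p q (A : 'M[R]_(p, q)) v c :
  spec_norm A <= c -> enorm (A *m v) <= c * enorm v.
Proof.
by move=> Ac; apply: le_trans (enorm_mulmx_le _ _) _; rewrite ler_wpM2r ?enorm_ge0.
Qed.

Lemma dotv_signJ n m (u v : 'cV[R]_(n + m)) :
  dotv (signJ R n m *m u) (signJ R n m *m v) = dotv u v.
Proof.
rewrite -[u]vsubmxK -[v]vsubmxK /signJ !mul_block_col !mul1mx !mul0mx !mulNmx.
by rewrite !mul1mx !addr0 !add0r !dotv_col_mx dotvNl dotvNr opprK.
Qed.

Lemma signJK n m : signJ R n m *m signJ R n m = 1%:M.
Proof.
rewrite /signJ mulmx_block !mul1mx !mul0mx !mulmx0 !mulNmx !mul1mx opprK.
by rewrite !addr0 !add0r -scalar_mx_block.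
Qed.

Lemma dotv_signJl n m (u v : 'cV[R]_(n + m)) :
  dotv (signJ R n m *m u) v = dotv u (signJ R n m *m v).
Proof. by rewrite -[RHS]dotv_signJ mulmxA signJK mul1mx. Qed.

Lemma enorm_signJ n m (u : 'cV[R]_(n + m)) : enorm (signJ R n m *m u) = enorm u.
Proof. by rewrite /enorm dotv_signJ. Qed.

Lemma signJ_col n m (u : 'cV[R]_n) (v : 'cV[R]_m) :
  signJ R n m *m col_mx u v = col_mx u (- v).
Proof. by rewrite /signJ mul_block_col !mul0mx mul1mx mulNmx mul1mx addr0 add0r. Qed.

End Euclidean.

(** * One-variable calculus along lines *)

Section LineCalculus.
Variable R : realType.
Set Implicit Arguments.
Unset Strict Implicit.

Lemma is_derive_line (V W : normedModType R) (f : V -> W) (w a : V) (t : R) :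
  differentiable f (w + t *: a) ->
  is_derive t 1 (fun s => f (w + s *: a)) ('d f (w + t *: a) a).
Proof.
move=> df.
have E : (fun h : R => h^-1 *: (((fun s => f (w + s *: a)) \o shift t) (h *: (1 : R))
              - f (w + t *: a)))
  = (fun h => h^-1 *: ((f \o shift (w + t *: a)) (h *: a) - f (w + t *: a))).
  apply/funext => h /=; congr (_ *: (f _ - _)).
  by rewrite [h *: 1]mulr1 scalerDl addrCA.
split; first by rewrite /derivable E; apply: diff_derivable.
by rewrite /derive E -deriveE.
Qed.

Lemma dotv_continuous N (e : 'cV[R]_N) : continuous (dotv e).
Proof.
have -> : dotv e = (fun v => \sum_i e i 0 * v i 0).
  by apply/funext => v; rewrite dotvE.
apply: (continuous_big (@add_continuous R)) => i _ v.
by apply: continuousM; [exact: cst_continuous|exact: coord_continuous].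
Qed.

(** Pairing with a fixed vector turns a vector-valued curve into a real function, to which the mean
    value theorem applies. *)
Lemma is_derive_dotv N (e : 'cV[R]_N) (phi : R -> 'cV[R]_N) (t : R) dphi :
  is_derive t 1 phi dphi ->
  is_derive t 1 (fun s => dotv e (phi s)) (dotv e dphi).
Proof.
case=> [dp dpE].
have E : (fun h : R => h^-1 *: (((fun s => dotv e (phi s)) \o shift t) (h *: (1 : R))
              - dotv e (phi t)))
  = dotv e \o (fun h => h^-1 *: ((phi \o shift t) (h *: (1 : R)) - phi t)).
  by apply/funext => h /=; rewrite dotvZr dotvBr.
have C : (h^-1 *: (((fun s => dotv e (phi s)) \o shift t) (h *: (1 : R))
              - dotv e (phi t))) @[h --> (0:R)^'] --> dotv e dphi.
  rewrite E -dpE; apply: cvg_comp; first exact: dp.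
  exact: dotv_continuous.
by split; [apply: cvgP C | apply: cvg_lim C].
Qed.

(** The slope over [0, t] is at most [c + K * t]; letting t decrease to 0 leaves [c]. This turns the
    chord inequalities of strong convexity and monotonicity into bounds on derivatives. *)
Lemma derive_le_of_slope (phi : R -> R) dphi c K : 0 <= K ->
  is_derive (0 : R) 1 phi dphi ->
  (forall t, 0 < t <= 1 -> phi t - phi 0 <= t * (c + K * t)) -> dphi <= c.
Proof.
move=> K0 [dp <-] h.
apply/ler_addgt0Pr => e e0.
have dpr := cvg_dnbhs_at_right dp.
apply: (cvgr_to_le dpr); near=> t.
have t0 : 0 < t by near: t; exact: nbhs_right_gt.
have t1 : t <= 1 by near: t; apply: nbhs_right_le.
(* This gives [K * t <= e]; the added 1 keeps the denominator positive when [K] is 0. *)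
have te : t <= e / (K + 1).
  by near: t; apply: nbhs_right_le; rewrite divr_gt0// ltr_pwDr.
rewrite /= [t *: 1]mulr1 addr0 [_ *: _]mulrC ler_pdivrMr//.
have := h t; rewrite t0 t1 => /(_ isT)/le_trans; apply.
rewrite mulrC ler_pM2r// lerD2l.
move: te; rewrite ler_pdivlMr ?ltr_pwDr//; nra.
Unshelve. all: by end_near.
Qed.

Lemma MVT_line (phi dphi : R -> R) :
  (forall t : R, is_derive t 1 phi (dphi t)) ->
  exists2 c, 0 <= c <= 1 & phi 1 - phi 0 = dphi c.
Proof.
move=> d.
have cphi : {within `[0, 1], continuous phi}.
  by apply: derivable_within_continuous => t _; apply: ex_derive.
have [c c01 ->] := MVT_segment ler01 (fun t _ => d t) cphi.
by exists c; rewrite ?subr0 ?mulr1// -in_itv.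
Qed.

(** The mean value theorem is applied to [phi] minus the primitive [c * t + K / 2 * t ^+ 2] of the
    bound, which replaces integration and keeps the factor 1/2. *)
Lemma diff_le_of_derive_le (phi dphi : R -> R) c K :
  (forall t : R, is_derive t 1 phi (dphi t)) ->
  (forall t, 0 <= t <= 1 -> dphi t <= c + K * t) ->
  phi 1 - phi 0 <= c + K / 2.
Proof.
move=> d h.
pose psi t := phi t - (c * t + K / 2 * t ^+ 2).
have dpsi (t : R) : is_derive t 1 psi (dphi t - (c + K * t)).
  have := d t => dt; apply: is_derive_eq.
  by rewrite /GRing.scale /=; field.
have [t t01 E] := MVT_line dpsi.
have := h _ t01; rewrite -subr_le0 -E /psi; lra.
Qed.

End LineCalculus.

(** * Lipschitz bounds and symmetry of the Hessian *)

Section ConvexConcave.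
Set Implicit Arguments.
Unset Strict Implicit.
Variables (R : realType) (n m : nat).
Variables (f : 'cV[R]_(n + m) -> R) (g : 'cV[R]_(n + m) -> 'cV[R]_(n + m)).
Variable H : 'cV[R]_(n + m) -> 'M[R]_(n + m).
Variables mu L L2 : R.
Hypothesis df : forall w, differentiable f w.
Hypothesis dfE : forall w v, 'd f w v = dotv (g w) v.
Hypothesis dg : forall w, differentiable g w.
Hypothesis dgE : forall w v, 'd g w v = H w *m v.
Hypothesis mu_gt0 : 0 < mu.
Hypothesis fx : strongly_convex_in_x f mu.
Hypothesis fy : strongly_concave_in_y f mu.
Hypothesis JFL : forall w, spec_norm (JF H w) <= L.
Hypothesis JFL2 : forall w w', spec_norm (JF H w - JF H w') <= L2 * enorm (w - w').

Lemma le0_of_le_small (x K : R) : (forall t, 0 < t <= 1 -> x <= K * t) -> x <= 0.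
Proof.
move=> h; rewrite leNgt; apply/negP => x0.
have := normr_ge0 K; have := ler_norm K; set k := `|K| => Kk k0.
have d0 : 0 < 2 * (k + x) by lra.
(* With k = |K|, the witness t = x / (2 (k + x)) gives [K * t <= x / 2], which is less than x. *)
have t0 : 0 < x / (2 * (k + x)) by rewrite divr_gt0.
have t1 : x / (2 * (k + x)) <= 1 by rewrite ler_pdivrMr//; lra.
have := h _ (introT andP (conj t0 t1)).
rewrite mulrA ler_pdivlMr//; nra.
Qed.

Lemma is_derive_f w a (t : R) :
  is_derive t 1 (fun s => f (w + s *: a)) (dotv (g (w + t *: a)) a).
Proof. by rewrite -dfE; apply: is_derive_line. Qed.

Lemma is_derive_dotg w a e (t : R) :
  is_derive t 1 (fun s => dotv e (g (w + s *: a))) (dotv e (H (w + t *: a) *m a)).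
Proof. by rewrite -dgE; apply/is_derive_dotv/is_derive_line. Qed.

Lemma dotv_Fmap e w : dotv e (Fmap g w) = dotv (signJ R n m *m e) (g w).
Proof. by rewrite dotv_signJl. Qed.

Lemma is_derive_dotF w a e (t : R) :
  is_derive t 1 (fun s => dotv e (Fmap g (w + s *: a)))
                (dotv e (JF H (w + t *: a) *m a)).
Proof.
rewrite /JF -mulmxA -dotv_signJl.
rewrite (_ : (fun s => _) = fun s => dotv (signJ R n m *m e) (g (w + s *: a))).
  exact: is_derive_dotg.
by apply/funext => s; rewrite dotv_Fmap.
Qed.

Lemma dotv_JF_lip e a w w' :
  dotv e (JF H w *m a) - dotv e (JF H w' *m a)
    <= L2 * enorm (w - w') * (enorm e * enorm a).
Proof.
rewrite -dotvBr -mulmxBl; apply: le_trans (dotv_le _ _) _.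
rewrite mulrCA; apply: ler_wpM2l; first exact: enorm_ge0.
exact/enorm_mulmx_le_of/JFL2.
Qed.

Lemma dotv_H_lip e a w w' :
  dotv e (H w *m a) - dotv e (H w' *m a)
    <= L2 * enorm (w - w') * (enorm e * enorm a).
Proof.
have := dotv_JF_lip (signJ R n m *m e) a w w'.
by rewrite /JF -!mulmxA !dotv_signJ enorm_signJ.
Qed.

(* The left-hand side is symmetric in [a] and [b], whence the symmetry of the Hessian. *)
Lemma second_difference w a b :
  exists2 xi, enorm (xi - w) <= enorm a + enorm b &
    f (w + a + b) - f (w + a) - f (w + b) + f w = dotv a (H xi *m b).
Proof.
pose phi (t : R) := f (w + b + t *: a) - f (w + t *: a).
have dphi (t : R) : is_derive t 1 phi
    (dotv (g (w + b + t *: a)) a - dotv (g (w + t *: a)) a).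
  by apply: is_deriveB; exact: is_derive_f.
(* One mean value along [a], then one along [b]: the intermediate point is [w] plus fractions of
   both, hence close to [w]. *)
have [c c01 phiE] := MVT_line dphi.
have [s s01 psiE] := MVT_line (is_derive_dotg (w + c *: a) b a).
exists (w + c *: a + s *: b).
  rewrite -[w + _ + _]addrA [w + _ - w]addrAC subrr add0r; apply: le_trans (enormD _ _) _.
  move: c01 s01 => /andP[c0 c1] /andP[s0 s1].
  rewrite !enormZ !ger0_norm//.
  by apply: lerD; apply: ler_piMl => //; exact: enorm_ge0.
rewrite -psiE !scale1r !scale0r !addr0.
rewrite ![dotv a _]dotvC (addrAC w (c *: a) b) -phiE /phi !scale1r !scale0r !addr0.
by rewrite (addrAC w b a); ring.
Qed.

Lemma L2_ge0 : (0 < n + m)%N -> 0 <= L2.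
Proof.
move=> N0; pose e : 'cV[R]_(n + m) := const_mx 1.
have e0 : 0 < enorm e.
  rewrite lt_neqAle enorm_ge0 andbT eq_sym; apply/eqP => /enorm_eq0.
  by move=> /matrixP/(_ (Ordinal N0) 0)/eqP; rewrite !mxE oner_eq0.
have := le_trans (spec_norm_ge0 _) (JFL2 e 0).
by rewrite subr0 pmulr_lge0.
Qed.

(** The second differences for [t *: a] and [t *: b] taken in either order agree. After division by
    t^2 they are values of the Hessian form at points within t (|a| + |b|) of [w], so the Lipschitz
    bound leaves an asymmetry of order t. *)
Lemma H_sym_le w a b : 0 <= L2 -> dotv a (H w *m b) - dotv b (H w *m a) <= 0.
Proof.
move=> L20.
apply: (@le0_of_le_small _ (2 * L2 * (enorm a + enorm b) * (enorm a * enorm b))).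
move=> t /andP[t0 t1].
have [xi xib E1] := second_difference w (t *: a) (t *: b).
have [xi' xib' E2] := second_difference w (t *: b) (t *: a).
have {E1 E2} E : dotv (t *: a) (H xi *m (t *: b)) = dotv (t *: b) (H xi' *m (t *: a)).
  by rewrite -E1 -E2 (addrAC w (t *: b)); ring.
move: E; rewrite -!scalemxAr !dotvZr !dotvZl => E.
have {}E : dotv a (H xi *m b) = dotv b (H xi' *m a).
  by apply: (mulfI (lt0r_neq0 t0)); apply: (mulfI (lt0r_neq0 t0)).
move: xib xib'; rewrite !enormZ gtr0_norm// => xib xib'.
have B1 := dotv_H_lip a b w xi; have B2 := dotv_H_lip b a xi' w.
rewrite enormB in B1.
have ab0 : 0 <= enorm a * enorm b by rewrite mulr_ge0 ?enorm_ge0.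
have lip (d p : R) : d <= t * enorm a + t * enorm b ->
    L2 * d * (enorm a * enorm b) <= L2 * (t * (enorm a + enorm b)) * (enorm a * enorm b).
  by move=> dp; rewrite -mulrDr in dp; rewrite ler_wpM2r// ler_wpM2l.
have := lip _ 0 xib; rewrite (addrC (t * _)) in xib'; have := lip _ 0 xib'.
rewrite (mulrC (enorm b)) in B2; lra.
Qed.

Lemma H_sym w a b : dotv a (H w *m b) = dotv b (H w *m a).
Proof.
have [N0|] := posnP (n + m); first by rewrite !dotv_dim0.
move=> /L2_ge0 L20; apply/eqP; rewrite eq_le -subr_le0 H_sym_le//.
by rewrite -subr_le0 H_sym_le.
Qed.

(** * First-order inequalities, strong monotonicity and Taylor bound for F *)

Lemma convex_grad x1 x2 y :
  f (col_mx x2 y) + dotv (g (col_mx x2 y)) (col_mx (x1 - x2) 0)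
    + mu / 2 * enorm (x1 - x2) ^+ 2 <= f (col_mx x1 y).
Proof.
set w := col_mx x2 y; set a := col_mx (x1 - x2) 0.
have dphi := is_derive_f w a 0; rewrite scale0r addr0 in dphi.
set q := mu / 2 * _.
have q0 : 0 <= q by rewrite mulr_ge0 ?sqr_ge0 ?divr_ge0 ?(ltW mu_gt0).
have := derive_le_of_slope (c := f (col_mx x1 y) - f w - q) q0 dphi.
(* The quadratic gain in the chord inequality is [q * t * (1 - t)]. Its part [q * t] stays in the
   limit, and the rest is the error [q * t ^+ 2]. *)
suff h t : 0 < t <= 1 -> f (w + t *: a) - f (w + 0 *: a)
    <= t * (f (col_mx x1 y) - f w - q + q * t) by move=> /(_ h); lra.
move=> /andP[t0 t1]; rewrite scale0r addr0.
have -> : w + t *: a = col_mx (t *: x1 + (1 - t) *: x2) y.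
  rewrite /w /a scale_col_mx add_col_mx scaler0 addr0; congr col_mx.
  by rewrite scalerBr scalerBl scale1r addrCA.
have := @fx x1 x2 y t; rewrite (ltW t0) t1 => /(_ isT).
rewrite -/w /q; lra.
Qed.

Lemma concave_grad x y1 y2 :
  f (col_mx x y1) <= f (col_mx x y2) + dotv (g (col_mx x y2)) (col_mx 0 (y1 - y2))
    - mu / 2 * enorm (y1 - y2) ^+ 2.
Proof.
set w := col_mx x y2; set a := col_mx 0 (y1 - y2).
have dphi := is_deriveN (is_derive_f w a 0); rewrite scale0r addr0 in dphi.
set q := mu / 2 * _.
have q0 : 0 <= q by rewrite mulr_ge0 ?sqr_ge0 ?divr_ge0 ?(ltW mu_gt0).
have := derive_le_of_slope (c := f w - f (col_mx x y1) - q) q0 dphi.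
suff h t : 0 < t <= 1 -> - f (w + t *: a) - - f (w + 0 *: a)
    <= t * (f w - f (col_mx x y1) - q + q * t) by move=> /(_ h); lra.
move=> /andP[t0 t1]; rewrite scale0r addr0.
have -> : w + t *: a = col_mx x (t *: y1 + (1 - t) *: y2).
  rewrite /w /a scale_col_mx add_col_mx scaler0 addr0; congr col_mx.
  by rewrite scalerBr scalerBl scale1r addrCA.
have := @fy x y1 y2 t; rewrite (ltW t0) t1 => /(_ isT).
rewrite -/w /q; lra.
Qed.

Lemma F_monotone z z' :
  mu * enorm (z - z') ^+ 2 <= dotv (Fmap g z - Fmap g z') (z - z').
Proof.
rewrite -[z]vsubmxK -[z']vsubmxK.
move: (usubmx z) (dsubmx z) (usubmx z') (dsubmx z') => x y x' y'.
(* Going around the rectangle with corners (x, y), (x', y), (x', y'), (x, y'), the values of [f]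
   cancel in the sum of the four inequalities, leaving the gradients at [z] and [z'] only. *)
have := convex_grad x' x y; have := convex_grad x x' y'.
have := concave_grad x y' y; have := concave_grad x' y y'.
rewrite opp_col_mx add_col_mx sqr_enorm_col.
rewrite (enormB x' x) (enormB y' y).
rewrite dotvBl ![dotv (Fmap g _) _]dotvC !dotv_Fmap !signJ_col.
have E u v w : dotv (col_mx u (- v)) w = dotv w (col_mx u 0) - dotv w (col_mx 0 v).
  rewrite -dotvBr dotvC opp_col_mx add_col_mx oppr0 addr0 add0r //.
rewrite !E.
have N u v : col_mx (u - v) 0 = - (col_mx (v - u) 0 : 'cV[R]_(n + m)).
  by rewrite opp_col_mx opprB oppr0.
have N' u v : col_mx 0 (u - v) = - (col_mx 0 (v - u) : 'cV[R]_(n + m)).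
  by rewrite opp_col_mx opprB oppr0.
rewrite (N x' x) (N' y' y) !dotvNr; lra.
Qed.

(** This is [F_monotone] between [z + t *: a] and [z], divided by t^2 and taken to the limit. The
    signs are reversed because [derive_le_of_slope] bounds from above. *)
Lemma JF_monotone z a : mu * enorm a ^+ 2 <= dotv a (JF H z *m a).
Proof.
have dphi := is_deriveN (is_derive_dotF z a a 0); rewrite scale0r addr0 in dphi.
have := derive_le_of_slope (c := - (mu * enorm a ^+ 2)) (lexx 0) dphi.
suff h t : 0 < t <= 1 -> - dotv a (Fmap g (z + t *: a)) - - dotv a (Fmap g (z + 0 *: a))
    <= t * (- (mu * enorm a ^+ 2) + 0 * t) by move=> /(_ h); lra.
move=> /andP[t0 t1]; rewrite scale0r addr0.
have := F_monotone (z + t *: a) z.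
rewrite [z + _ - z]addrAC subrr add0r enormZ gtr0_norm// dotvZr [dotv _ a]dotvC dotvBr.
rewrite exprMn mulrCA expr2 -mulrA ler_pM2l// => h.
by rewrite mul0r addr0 mulrN; lra.
Qed.

Lemma enorm_JF_ge z a : mu * enorm a <= enorm (JF H z *m a).
Proof.
have [a0|a0] := eqVneq (enorm a) 0; first by rewrite a0 mulr0 enorm_ge0.
have {}a0 : 0 < enorm a by rewrite lt_neqAle eq_sym a0 enorm_ge0.
rewrite -(ler_pM2l a0); apply: le_trans (dotv_le _ _).
by apply: le_trans (JF_monotone _ _); lra.
Qed.

(** The increment [e] of F is paired with itself, so a single real mean value gives |e|^2 <= |e| L
    |z - z'|. *)
Lemma F_lipschitz z z' : enorm (Fmap g z - Fmap g z') <= L * enorm (z - z').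
Proof.
set e := Fmap g z - Fmap g z'.
have [e0|e0] := eqVneq (enorm e) 0.
  rewrite e0 mulr_ge0 ?enorm_ge0//; exact: le_trans (spec_norm_ge0 _) (JFL z).
have {}e0 : 0 < enorm e by rewrite lt_neqAle eq_sym e0 enorm_ge0.
have [c c01] := MVT_line (is_derive_dotF z' (z - z') e).
rewrite scale1r scale0r addr0 addrCA subrr addr0 -dotvBr -/e -sqr_enorm => E.
rewrite -(ler_pM2l e0) -expr2 E; apply: le_trans (dotv_le _ _) _.
by rewrite ler_pM2l//; apply: enorm_mulmx_le_of.
Qed.

Lemma F_taylor z h e :
  dotv e (Fmap g (z + h) - Fmap g z - JF H z *m h)
    <= L2 / 2 * enorm e * enorm h ^+ 2.
Proof.
have dphi := is_derive_dotF z h e.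
have := diff_le_of_derive_le (c := dotv e (JF H z *m h))
  (K := L2 * enorm e * enorm h ^+ 2) dphi.
rewrite scale1r scale0r addr0 !dotvBr => B.
suff /B : forall t, 0 <= t <= 1 -> dotv e (JF H (z + t *: h) *m h)
   <= dotv e (JF H z *m h) + L2 * enorm e * enorm h ^+ 2 * t by lra.
move=> t /andP[t0 _]; have := dotv_JF_lip e h (z + t *: h) z.
rewrite [z + _ - z]addrAC subrr add0r enormZ ger0_norm//; lra.
Qed.

End ConvexConcave.

(** * Optimality conditions of the cubic model and slope of the merit along the step *)

Section CubicStep.
Set Implicit Arguments.
Unset Strict Implicit.
Variable R : realType.

Lemma eq0_of_local_min (B C : R) :
  (forall t, `|t| <= 1 -> 0 <= t * B + C * t ^+ 2) -> B = 0.
Proof.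
move=> h; apply/eqP; rewrite eq_le -[0 <= B]oppr_le0.
apply/andP; split; apply: (@le0_of_le_small _ _ C) => t /andP[t0 t1].
  have := h (- t); rewrite normrN ger0_norm ?(ltW t0)// => /(_ t1) ht.
  by rewrite -(ler_pM2l t0); lra.
have := h t; rewrite ger0_norm ?(ltW t0)// => /(_ t1) ht.
by rewrite -(ler_pM2l t0); lra.
Qed.

(** A linearisation of the cubed norm with error of order t^2. The optimality conditions of the
    model then follow by comparing values, without differentiating the norm. *)
Lemma enorm_cube_le N (u a : 'cV[R]_N) (t : R) : `|t| <= 1 ->
  enorm (u + t *: a) ^+ 3 <= enorm u ^+ 3 + t * (3 * enorm u * dotv u a)
    + (3 * enorm u + enorm a) * enorm a ^+ 2 * t ^+ 2.
Proof.
move=> t1.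
have E : enorm (u + t *: a) ^+ 2
    = enorm u ^+ 2 + 2 * t * dotv u a + t ^+ 2 * enorm a ^+ 2.
  by rewrite sqr_enormD enormZ exprMn real_normK ?num_real// dotvZr; ring.
have h1 := enormD u (t *: a).
have h2 := enormD (u + t *: a) (- (t *: a)).
rewrite addrK enormN in h2; rewrite enormZ in h1 h2.
have := enorm_ge0 u; have := enorm_ge0 a; have := enorm_ge0 (u + t *: a).
have tE : `|t| ^+ 2 = t ^+ 2 by rewrite real_normK ?num_real.
have := normr_ge0 t.
move: (enorm (u + t *: a)) (enorm u) (enorm a) (dotv u a) `|t| t1 E h1 h2 tE.
move=> q p c s T T1 E h1 h2 tE T0 q0 c0 p0.
(* In this identity q^2 - p^2 is an explicit polynomial in t, and the last term is of order t^2
   because |q - p| <= |t| |a|. *)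
have -> : q ^+ 3 = p ^+ 3 + 3 / 2 * p * (q ^+ 2 - p ^+ 2) + (q - p) ^+ 2 * (q + p / 2).
  by field.
have -> : q ^+ 2 - p ^+ 2 = 2 * t * s + t ^+ 2 * c ^+ 2 by rewrite E; ring.
rewrite -tE.
have d2 : (q - p) ^+ 2 <= (T * c) ^+ 2 by nra.
have q1 : q + p / 2 <= 3 / 2 * p + c.
  have : T * c <= c by rewrite ler_piMl.
  lra.
have : (q - p) ^+ 2 * (q + p / 2) <= (T * c) ^+ 2 * (3 / 2 * p + c).
  by apply: ler_pM => //; rewrite ?sqr_ge0//; lra.
lra.
Qed.

Variables (n m : nat).
Variables (f : 'cV[R]_(n + m) -> R) (g : 'cV[R]_(n + m) -> 'cV[R]_(n + m)).
Variable H : 'cV[R]_(n + m) -> 'M[R]_(n + m).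
Hypothesis Hsym : forall w a b, dotv a (H w *m b) = dotv b (H w *m a).

Lemma crn_modelE zk gam x y (u := x - usubmx zk) (v := y - dsubmx zk)
    (d := col_mx u v) :
  crn_model f g H zk gam x y =
  f zk + dotv (g zk) d + 2^-1 * dotv d (H zk *m d)
  + gam / 3 * enorm u ^+ 3 - gam / 3 * enorm v ^+ 3.
Proof.
rewrite /crn_model; have -> // : col_mx x y - zk = d.
by rewrite -{1}[zk]vsubmxK opp_col_mx add_col_mx.
Qed.

Lemma quadratic_shift zk d A (t : R) :
  dotv (g zk) (d + t *: A) + 2^-1 * dotv (d + t *: A) (H zk *m (d + t *: A))
  = dotv (g zk) d + 2^-1 * dotv d (H zk *m d)
    + t * dotv A (g zk + H zk *m d) + t ^+ 2 * (2^-1 * dotv A (H zk *m A)).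
Proof.
by rewrite mulmxDr -scalemxAr !dotv_lin (Hsym zk d A) (dotvC (g zk) A); field.
Qed.

Section Saddle.
Variables (zk : 'cV[R]_(n + m)) (gam : R) (xt : 'cV[R]_n) (yt : 'cV[R]_m).
Hypothesis gam_ge0 : 0 <= gam.
Hypothesis sad : is_saddle (crn_model f g H zk gam) xt yt.
Let u := xt - usubmx zk.
Let v := yt - dsubmx zk.
Let d := col_mx u v.

(** Moving to [xt + t *: a] cannot decrease the model, and changes it by at most t times the
    left-hand side plus [C * t ^+ 2]. Both signs of t force the linear coefficient to vanish. *)
Lemma saddle_x a : dotv (col_mx a 0) (g zk + H zk *m d) + gam * enorm u * dotv u a = 0.
Proof.
set A := col_mx a 0.
pose C := 2^-1 * dotv A (H zk *m A)
  + gam / 3 * ((3 * enorm u + enorm a) * enorm a ^+ 2).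
apply: (@eq0_of_local_min _ C) => t t1.
have [_] := sad (xt + t *: a) yt.
rewrite !crn_modelE -/u -/v -/d.
have -> : xt + t *: a - usubmx zk = u + t *: a by rewrite addrAC.
have -> : col_mx (u + t *: a) v = d + t *: A.
  by rewrite scale_col_mx add_col_mx scaler0 addr0.
have := quadratic_shift zk d A t.
have := ler_wpM2l gam_ge0 (enorm_cube_le u a t1).
rewrite /C; lra.
Qed.

Lemma saddle_y b : dotv (col_mx 0 b) (g zk + H zk *m d) - gam * enorm v * dotv v b = 0.
Proof.
set B := col_mx 0 b.
pose C := - (2^-1 * dotv B (H zk *m B))
  + gam / 3 * ((3 * enorm v + enorm b) * enorm b ^+ 2).
(* The saddle point is a maximum in y, so the condition is negated to become that of a local
   minimum. *)
apply: oppr_inj; rewrite oppr0; apply: (@eq0_of_local_min _ C) => t t1.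
have [+ _] := sad xt (yt + t *: b).
rewrite !crn_modelE -/u -/v -/d.
have -> : yt + t *: b - dsubmx zk = v + t *: b by rewrite addrAC.
have -> : col_mx u (v + t *: b) = d + t *: B.
  by rewrite scale_col_mx add_col_mx scaler0 addr0.
have := quadratic_shift zk d B t.
have := ler_wpM2l gam_ge0 (enorm_cube_le v b t1).
rewrite /C; lra.
Qed.

Lemma saddle_eq :
  Fmap g zk + JF H zk *m d
    + col_mx ((gam * enorm u) *: u) ((gam * enorm v) *: v) = 0.
Proof.
(* The equation is tested against every [col_mx a b]; the sign matrix flips [b], which yields the
   x-condition minus the y-condition. *)
set X := LHS; suff h a b : dotv (col_mx a b) X = 0.
  by apply: dotv_eq0; rewrite -{1}[X]vsubmxK.
rewrite /X /Fmap /JF -mulmxA -mulmxDr dotvDr -dotv_signJl signJ_col.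
have -> : col_mx a (- b) = col_mx a 0 - col_mx 0 b :> 'cV[R]_(n + m).
  by rewrite opp_col_mx add_col_mx oppr0 addr0 add0r.
rewrite dotvBl dotv_col_mx !dotvZr (dotvC a) (dotvC b).
by have := saddle_x a; have := saddle_y b; lra.
Qed.

End Saddle.

(** Cleared of denominators, the claim is [qq + 3/4 x^2 <= 2 p^2 + pq]. Inserting [qq <= x^2] and
    [pq >= - x (p - x) / 2] leaves [5/4 x^2 + x p / 2 <= 2 p^2], which holds since [x <= p]. *)
Lemma slope_scalar_le (p x r pq qq : R) :
  0 <= r -> r <= x -> x <= p -> r * (x - p) / 2 <= pq -> qq <= r ^+ 2 ->
  - (p ^+ 2 + pq) + x ^+ 2 / 4 <= - (3^-1 * (p ^+ 2 + 2 * pq + qq)).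
Proof.
move=> r0 rx xp PQ QQ; have x0 := le_trans r0 rx; have p0 := le_trans x0 xp.
have B1 : r * (p - x) <= x * (p - x) by rewrite ler_wpM2r// subr_ge0.
have B2 : r ^+ 2 <= x ^+ 2 by rewrite ler_sqr.
have B3 : x ^+ 2 <= p ^+ 2 by rewrite ler_sqr.
have x2 := sqr_ge0 x; have B4 : x * p <= p ^+ 2 by rewrite expr2 ler_wpM2r.
lra.
Qed.

(** For [P] the Jacobian applied to [d] and F = - (P + Q), the first term is the derivative of the
    merit along [d]. The term with 1/4 is the reserve that later absorbs the quadratic error of the
    damped step. *)
Lemma merit_slope (P : 'cV[R]_(n + m)) (u : 'cV[R]_n) (v : 'cV[R]_m) (mu gam : R)
    (d := col_mx u v) (Q := col_mx ((gam * enorm u) *: u) ((gam * enorm v) *: v)) :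
  0 < mu -> 0 <= gam -> gam * (enorm u + enorm v) <= mu ->
  mu * enorm d ^+ 2 <= dotv d P -> mu * enorm d <= enorm P ->
  dotv (P + Q) (- P) + mu ^+ 2 * enorm d ^+ 2 / 4 <= - (3^-1 * enorm (P + Q) ^+ 2).
Proof.
move=> mu0 gam0; set s := gam * _ => smu dP dP'.
have a0 := enorm_ge0 u; have b0 := enorm_ge0 v.
have e0 := enorm_ge0 d; have p0 := enorm_ge0 P.
have s0 : 0 <= s by rewrite mulr_ge0 ?addr_ge0.
pose del := gam * (enorm u - enorm v).
(* [diag(|u|, |v|) = (|u|+|v|)/2 I + (|u|-|v|)/2 J]: monotonicity controls the first part. *)
have QE : Q = (s / 2) *: d + (del / 2) *: (signJ R n m *m d).
  rewrite signJ_col !scale_col_mx add_col_mx /Q scalerN -scalerBl -scalerDl /s /del.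
  by congr (col_mx (_ *: _) (_ *: _)); field.
have PQ : s / 2 * (mu * enorm d ^+ 2) - s / 2 * (enorm d * enorm P) <= dotv P Q.
  rewrite QE dotvDr !dotvZr (dotvC P d).
  have J1 := dotv_le P (signJ R n m *m d); have J2 := dotv_geN P (signJ R n m *m d).
  rewrite enorm_signJ in J1 J2.
  have pd0 : 0 <= enorm P * enorm d by rewrite mulr_ge0.
  have d1 : del <= s by rewrite /del /s; nra.
  have d2 : - s <= del by rewrite /del /s; nra.
  have : s / 2 * (mu * enorm d ^+ 2) <= s / 2 * dotv d P by rewrite ler_wpM2l// divr_ge0.
  have : - (s * (enorm P * enorm d)) <= del * dotv P (signJ R n m *m d) by nra.
  lra.
have QQ : enorm Q ^+ 2 <= s ^+ 2 * enorm d ^+ 2.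
  have h : gam * enorm u <= s by rewrite /s ler_wpM2l// lerDl.
  have h' : gam * enorm v <= s by rewrite /s ler_wpM2l// lerDr.
  rewrite !sqr_enorm_col !enormZ !ger0_norm ?mulr_ge0// mulrDr -!exprMn.
  by apply: lerD; rewrite ler_sqr ?nnegrE ?mulr_ge0 ?addr_ge0// ler_wpM2r.
rewrite sqr_enormD dotvNr dotvDl -sqr_enorm (dotvC Q P).
(* Here p = |P|, x = mu |d| and r = s |d|: the backtracking test gives r <= x, and the lower bound
   on the Jacobian gives x <= p. *)
rewrite -exprMn; apply: (@slope_scalar_le _ _ (s * enorm d)).
- by rewrite mulr_ge0.
- by rewrite ler_wpM2r.
- by [].
- by move: PQ; lra.
- by rewrite exprMn.
Qed.

End CubicStep.

(** * Level set, quadratic upper bound for the merit, and decrease in one step *)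

Section Descent.
Set Implicit Arguments.
Unset Strict Implicit.
Variables (R : realType) (n m : nat).
Variables (f : 'cV[R]_(n + m) -> R) (g : 'cV[R]_(n + m) -> 'cV[R]_(n + m)).
Variable H : 'cV[R]_(n + m) -> 'M[R]_(n + m).
Variables mu L L2 : R.
Hypothesis df : forall w, differentiable f w.
Hypothesis dfE : forall w v, 'd f w v = dotv (g w) v.
Hypothesis dg : forall w, differentiable g w.
Hypothesis dgE : forall w v, 'd g w v = H w *m v.
Hypothesis mu_gt0 : 0 < mu.
Hypothesis fx : strongly_convex_in_x f mu.
Hypothesis fy : strongly_concave_in_y f mu.
Hypothesis JFL : forall w, spec_norm (JF H w) <= L.
Hypothesis JFL2 : forall w w', spec_norm (JF H w - JF H w') <= L2 * enorm (w - w').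
Hypothesis dim_gt0 : (0 < n + m)%N.

Let F := Fmap g.
Let monF := F_monotone df dfE mu_gt0 fx fy.
Let lipF := F_lipschitz dg dgE JFL.

(** Both constants bound |JF e| / |e| for a nonzero [e], one from below and one from above; positive
    dimension provides such a vector. *)
Lemma mu_le_L : mu <= L.
Proof.
pose e : 'cV[R]_(n + m) := const_mx 1.
have e0 : 0 < enorm e.
  rewrite lt_neqAle enorm_ge0 andbT eq_sym; apply/eqP => /enorm_eq0.
  by move=> /matrixP/(_ (Ordinal dim_gt0) 0)/eqP; rewrite !mxE oner_eq0.
rewrite -(ler_pM2r e0).
apply: le_trans (enorm_mulmx_le_of e (JFL 0)).
exact: (enorm_JF_ge df dfE dg dgE mu_gt0 fx fy).
Qed.

Let L_gt0 : 0 < L. Proof. exact: lt_le_trans mu_gt0 mu_le_L. Qed.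

Lemma merit_le w w' : (merit g w <= merit g w') = (enorm (F w) <= enorm (F w')).
Proof. by rewrite /merit ler_pM2l ?invr_gt0// ler_sqr ?nnegrE ?enorm_ge0. Qed.

Variable z0 : 'cV[R]_(n + m).
Let D := sup [set enorm (w - z0) | w in [set w | merit g w <= merit g z0]].
Let Lm := L ^+ 2 + L * L2 * D.

Lemma level_set_dist w : merit g w <= merit g z0 -> enorm (w - z0) <= D.
Proof.
move=> ww; apply: sup_upper_bound; last by exists w.
split; first by exists (enorm (z0 - z0)), z0 => /=.
(* Boundedness must be shown for the supremum to be meaningful: strong monotonicity gives mu |v -
   z0| <= |F v| + |F z0| <= 2 |F z0| on the level set. *)
exists (2 / mu * enorm (F z0)) => _ [v /= + <-].
rewrite merit_le => vz.
have [e0|e0] := eqVneq (enorm (v - z0)) 0.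
  by rewrite e0 mulr_ge0 ?enorm_ge0// divr_ge0// ltW.
have {}e0 : 0 < enorm (v - z0) by rewrite lt_neqAle eq_sym e0 enorm_ge0.
have h1 := le_trans (monF v z0) (dotv_le _ _).
have h2 := enormD (F v) (- F z0); rewrite enormN in h2.
move: h1; rewrite expr2 mulrA ler_pM2r// -/F => h1.
by rewrite mulrAC ler_pdivlMr// mulrC; lra.
Qed.

Lemma D_ge0 : 0 <= D.
Proof. exact: le_trans (enorm_ge0 _) (level_set_dist (lexx (merit g z0))). Qed.

(** The step length mu / L^2 minimises 1 - 2 mu tau + L^2 tau^2, the factor obtained from
    monotonicity and the Lipschitz bound. *)
Lemma F_descent w :
  enorm (F (w - (mu / L ^+ 2) *: F w)) ^+ 2
    <= (1 - (mu / L) ^+ 2) * enorm (F w) ^+ 2.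
Proof.
set tau := mu / L ^+ 2; set w' := w - _.
have tau0 : 0 < tau by rewrite divr_gt0// exprn_gt0.
have wE : w' - w = - (tau *: F w) by rewrite /w' addrAC subrr add0r.
have := monF w' w; have := lipF w' w; rewrite -/F wE enormN enormZ gtr0_norm//.
set e := F w' - F w; rewrite dotvNr dotvZr => h1 h2.
have -> : F w' = F w + e by rewrite /e addrC subrK.
rewrite sqr_enormD (dotvC (F w) e).
have h3 : enorm e ^+ 2 <= (L * (tau * enorm (F w))) ^+ 2.
  by rewrite ler_sqr ?nnegrE ?enorm_ge0// (le_trans _ h1)// enorm_ge0.
have h4 : dotv e (F w) <= - (mu * tau * enorm (F w) ^+ 2).
  rewrite -(ler_pM2l tau0); move: h2; rewrite exprMn; lra.
have E : (mu / L) ^+ 2 = mu * tau by rewrite /tau expr_div_n mulrA expr2.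
have E2 : (L * (tau * enorm (F w))) ^+ 2 = mu * tau * enorm (F w) ^+ 2.
  by rewrite /tau; field; rewrite lt0r_neq0.
rewrite E; lra.
Qed.

Lemma F_le_LD : enorm (F z0) <= L * D.
Proof.
set q := 1 - (mu / L) ^+ 2.
have r0 : 0 < mu / L by rewrite divr_gt0.
have r1 : mu / L <= 1 by rewrite ler_pdivrMr// mul1r mu_le_L.
have q01 : 0 <= q < 1.
  have := exprn_gt0 2 r0; have : (mu / L) ^+ 2 <= 1 by rewrite expr_le1// ltW.
  by rewrite /q; lra.
have /andP[q0 q1] := q01.
have iter k : exists w, enorm (F w) ^+ 2 <= q ^+ k * enorm (F z0) ^+ 2.
  elim: k => [|k [w IH]]; first by exists z0; rewrite mul1r.
  exists (w - (mu / L ^+ 2) *: F w); apply: le_trans (F_descent w) _.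
  by rewrite [q ^+ _]exprS -mulrA -/q ler_wpM2l.
rewrite leNgt; apply/negP; set eps := L * D => lt.
have [h|h] := leP (enorm (F z0)) 0.
  have := mulr_ge0 (ltW L_gt0) D_ge0; rewrite -/eps; lra.
(* The iterates lie in the level set, so |F z0| - |F w| <= L |z0 - w| <= L D. A strict excess over L
   D would keep |F w| away from 0, against the geometric decay. *)
have low k : (enorm (F z0) - eps) ^+ 2 <= q ^+ k * enorm (F z0) ^+ 2.
  have [w hw] := iter k; apply: (le_trans _ hw).
  rewrite ler_sqr ?nnegrE ?enorm_ge0 ?subr_ge0 ?(ltW lt)//.
  have wz : merit g w <= merit g z0.
    rewrite merit_le -ler_sqr ?nnegrE ?enorm_ge0//; apply: (le_trans hw).
    by rewrite ler_piMl ?sqr_ge0// exprn_ile1// ltW.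
  have := lipF z0 w; rewrite -/F (enormB z0 w) => h1.
  have := ler_wpM2l (ltW L_gt0) (level_set_dist wz); rewrite -/eps.
  have := enormD (F z0 - F w) (F w); rewrite subrK; lra.
have : (enorm (F z0) - eps) ^+ 2 <= 0.
  have C : (fun k => q ^+ k * enorm (F z0) ^+ 2) @ \oo --> 0 * enorm (F z0) ^+ 2.
    by apply: cvgMl; apply: cvg_expr; rewrite ger0_norm.
  rewrite mul0r in C; apply: (cvgr_to_ge C).
  by apply: nearW => k; exact: low.
by rewrite leNgt exprn_gt0// subr_gt0.
Qed.

Lemma Lm_ge : L ^+ 2 <= Lm.
Proof.
by rewrite /Lm lerDl !mulr_ge0 ?D_ge0 ?(L2_ge0 JFL2)// ltW.
Qed.

Let Lm_gt0 : 0 < Lm.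
Proof. by apply: lt_le_trans Lm_ge; rewrite exprn_gt0. Qed.

Lemma mu2_le_Lm : mu ^+ 2 <= Lm.
Proof.
by apply: le_trans Lm_ge; rewrite ler_sqr ?nnegrE ?mu_le_L// ltW.
Qed.

(** Write E for the increment of F. The Taylor error in <F w, E> contributes L L2 D |h|^2 / 2 and
    the term |E|^2 / 2 contributes L^2 |h|^2 / 2; their sum has the constant [Lm / 2]. The level set
    condition is imposed at [w] only, not at [w + h]. *)
Lemma merit_step w h : merit g w <= merit g z0 ->
  merit g (w + h) <= merit g w + dotv (F w) (JF H w *m h) + Lm / 2 * enorm h ^+ 2.
Proof.
rewrite merit_le => wz.
have FLD : enorm (F w) <= L * D := le_trans wz F_le_LD.
set E := F (w + h) - F w.
have -> : merit g (w + h) = merit g w + dotv (F w) E + enorm E ^+ 2 / 2.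
  rewrite /merit -/F; have -> : F (w + h) = F w + E by rewrite /E subrKC.
  by rewrite sqr_enormD; field.
have T := F_taylor dg dgE JFL2 w h (F w).
rewrite -/F -/E dotvBr in T.
have EL := lipF (w + h) w; rewrite [w + h - w]addrAC subrr add0r -/E in EL.
have E2 : enorm E ^+ 2 <= L ^+ 2 * enorm h ^+ 2.
  by rewrite -exprMn ler_sqr ?nnegrE ?enorm_ge0// (le_trans _ EL)// enorm_ge0.
have : L2 * enorm (F w) * enorm h ^+ 2 <= L2 * (L * D) * enorm h ^+ 2.
  by rewrite ler_wpM2r ?sqr_ge0// ler_wpM2l// (L2_ge0 JFL2).
rewrite /Lm; lra.
Qed.

Let alpha := mu ^+ 2 / (2 * Lm).

Lemma crn_step_merit gbar rho w w' : 0 < gbar -> 0 < rho ->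
  merit g w <= merit g z0 -> crn_step f g H mu gbar rho alpha w w' ->
  merit g w' <= (1 - mu ^+ 2 / (6 * Lm)) ^+ 2 * merit g w.
Proof.
move=> gbar0 rho0 wz [j [xt [yt []]]].
set gam := gbar * _; set u := xt - _; set v := yt - _; set d := col_mx u v.
move=> sad gmu _ w'E.
have gam0 : 0 <= gam by rewrite mulr_ge0 ?exprn_ge0 ?ltW.
have Hs := H_sym df dfE dg dgE JFL2.
have := saddle_eq Hs gam0 sad; rewrite -/u -/v -/d -/F.
set P := JF H w *m d; set Q := col_mx _ _ => FPQ.
have FE : F w = - (P + Q) by apply/eqP; rewrite -addr_eq0 addrA FPQ.
have := merit_slope (P := P) mu_gt0 gam0 gmu
  (JF_monotone df dfE dg dgE mu_gt0 fx fy w d)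
  (enorm_JF_ge df dfE dg dgE mu_gt0 fx fy w d).
rewrite -/d -/Q dotvNr -dotvNl -[enorm (P + Q)]enormN -!FE => slope.
have a0 : 0 < alpha by rewrite divr_gt0 ?exprn_gt0// mulr_gt0.
(* The selection rule keeps a point no worse than the damped one, so it suffices to bound the merit
   there. *)
have le_min : merit g w' <= merit g (w + alpha *: d).
  by rewrite w'E; case: ltP.
apply: le_trans le_min _; apply: le_trans (merit_step _ wz) _.
rewrite -scalemxAr dotvZr -/P enormZ gtr0_norm// exprMn.
have -> : mu ^+ 2 / (6 * Lm) = alpha / 3.
  by rewrite /alpha; field; rewrite lt0r_neq0.
(* The choice of [alpha] makes the quadratic error exactly alpha times the reserve mu^2 |d|^2 / 4 of
   [merit_slope]. *)
have aL : Lm / 2 * alpha ^+ 2 = alpha * (mu ^+ 2 / 4).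
  by rewrite /alpha; field; rewrite lt0r_neq0.
rewrite mulrA aL.
have ME : enorm (F w) ^+ 2 = 2 * merit g w by rewrite /merit; field.
have M0 : 0 <= merit g w by rewrite /merit mulr_ge0 ?invr_ge0 ?sqr_ge0.
have := ler_wpM2l (ltW a0) slope; rewrite ME.
(* This term, divided by 9, is the gap between (1 - alpha / 3)^2 and 1 - 2 alpha / 3. *)
have : 0 <= alpha ^+ 2 * merit g w by rewrite mulr_ge0 ?sqr_ge0.
lra.
Qed.

End Descent.

(** * Linear rate, convergence and iteration count *)

Theorem theorem3p5 (R : realType) (n m : nat)
  (f : 'cV[R]_(n + m) -> R) (g : 'cV[R]_(n + m) -> 'cV[R]_(n + m))
  (H : 'cV[R]_(n + m) -> 'M[R]_(n + m))
  (mu L L2 gbar rho : R) (z : nat -> 'cV[R]_(n + m)) :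
  (* f is C^2 with gradient g and Hessian H *)
  (forall w, differentiable f w) -> (forall w v, 'd f w v = dotv (g w) v) ->
  (forall w, differentiable g w) -> (forall w v, 'd g w v = H w *m v) ->
  continuous H ->
  0 < mu -> strongly_convex_in_x f mu -> strongly_concave_in_y f mu ->
  (forall w, spec_norm (JF H w) <= L) ->
  (forall w w', spec_norm (JF H w - JF H w') <= L2 * enorm (w - w')) ->
  0 < gbar -> 0 < rho < 1 ->
  let D := sup [set enorm (w - z 0%N) | w in [set w | merit g w <= merit g (z 0%N)]] in
  let Lm := L ^+ 2 + L * L2 * D in
  let alpha := mu ^+ 2 / (2 * Lm) in
  (forall k : nat, crn_step f g H mu gbar rho alpha (z k) (z k.+1)) ->
  [/\ (forall k : nat, merit g (z k.+1) <= (1 - mu ^+ 2 / (6 * Lm)) ^+ 2 * merit g (z k)),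
      (merit g \o z) @ \oo --> (0 : R)
    & (forall eps : R, 0 < eps -> forall k : nat,
        3 * Lm / mu ^+ 2 * ln (merit g (z 0%N) / eps) <= k%:R -> merit g (z k) <= eps)].
Proof.
move=> df dfE dg dgE _ mu0 fx fy JFL JFL2 gbar0 /andP[rho0 _] D Lm alpha steps.
have merit_ge0 w : 0 <= merit g w by rewrite /merit mulr_ge0 ?invr_ge0 ?sqr_ge0.
(* In dimension zero the merit vanishes identically; positive dimension is what yields [mu <= L] and
   [0 <= L2]. *)
have [N0|N0] := posnP (n + m).
  have m0 w : merit g w = 0 by rewrite /merit sqr_enorm dotv_dim0 ?mulr0.
  split=> [k||eps eps0 k _]; first by rewrite !m0 mulr0.
    have -> : merit g \o z = cst 0 by apply/funext => k; exact: m0.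
    exact: cvg_cst.
  by rewrite m0 ltW.
have muLm := mu2_le_Lm df dfE dg dgE mu0 fx fy JFL JFL2 N0 (z 0%N).
have stepE k (level_k : merit g (z k) <= merit g (z 0%N)) :=
  crn_step_merit df dfE dg dgE mu0 fx fy JFL JFL2 N0 gbar0 rho0 level_k (steps k).
rewrite -/D -/Lm in muLm stepE *.
set r := mu ^+ 2 / (6 * Lm) in stepE *.
have mu20 : 0 < mu ^+ 2 by rewrite exprn_gt0.
have Lm0 : 0 < Lm := lt_le_trans mu20 muLm.
have r0 : 0 < r by rewrite divr_gt0// mulr_gt0.
have r1 : r <= 6^-1 by rewrite ler_pdivrMr ?mulr_gt0//; lra.
set q := (1 - r) ^+ 2 in stepE *.
have q0 : 0 <= q by rewrite sqr_ge0.
have q1 : q < 1 by rewrite /q; nra.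
(* The one-step bound assumes membership in the initial level set, and in turn preserves it because
   q < 1. *)
have level k : merit g (z k) <= merit g (z 0%N).
  elim: k => [//|k IH]; apply: le_trans (stepE _ IH) _.
  by apply: le_trans IH; rewrite ler_piMl// ltW.
have geo k : merit g (z k) <= q ^+ k * merit g (z 0%N).
  elim: k => [|k IH]; first by rewrite mul1r.
  apply: le_trans (stepE _ (level k)) _.
  by rewrite [q ^+ k.+1]exprS -mulrA ler_wpM2l.
split=> [k||eps eps0 k kbig]; first exact: stepE.
  apply: (@squeeze_cvgr _ _ _ _ (cst 0) (fun k => q ^+ k * merit g (z 0%N))).
  - by apply: nearW => k /=; rewrite merit_ge0 geo.
  - exact: cvg_cst.
  - rewrite -[X in _ --> X](mul0r (merit g (z 0%N))).
    by apply: cvgMl; apply: cvg_expr; rewrite ger0_norm.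
apply: le_trans (geo k) _.
have [m0|m0] := eqVneq (merit g (z 0%N)) 0; first by rewrite m0 mulr0 ltW.
have {}m0 : 0 < merit g (z 0%N) by rewrite lt_neqAle eq_sym m0 merit_ge0.
(* This is 1 - r <= exp(-r), squared; the bound r <= 1/6 makes 1 - r nonnegative. *)
have qexp : q <= expR (2%:R * - r).
  rewrite expRM_natl ler_sqr ?nnegrE ?expR_ge0//; first exact: expR_ge1Dx.
  by lra.
have qk : q ^+ k <= expR (- (2 * r * k%:R)).
  rewrite -mulNr -mulrN expRM_natr.
  by apply: lerXn2r; rewrite ?nnegrE ?expR_ge0.
have ME : merit g (z 0%N) = eps * expR (ln (merit g (z 0%N) / eps)).
  by rewrite lnK ?posrE ?divr_gt0// mulrCA divff ?mulr1// lt0r_neq0.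
have lnk : ln (merit g (z 0%N) / eps) <= 2 * r * k%:R.
  (* Since 2 r = mu^2 / (3 Lm), the threshold on k is ln(m(z^0) / eps) / (2 r). Its factor 3 Lm /
     mu^2 equals 3 (kappa^2 + kappa L2 D / mu), the announced order with D in the constant. *)
  have -> : 2 * r * k%:R = k%:R / (3 * Lm / mu ^+ 2).
    by rewrite /r; field; rewrite !lt0r_neq0.
  by rewrite ler_pdivlMr ?divr_gt0 ?mulr_gt0// mulrC.
rewrite {}ME mulrCA ler_piMr ?(ltW eps0)//.
apply: (@le_trans _ _ (expR (- (2 * r * k%:R)) * expR (2 * r * k%:R))).
  apply: ler_pM; [exact: exprn_ge0 | exact: expR_ge0 | exact: qk |].
  by rewrite ler_expR.
by rewrite -expRD addNr expR0.
Qed.
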